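(* Let $p\in(0,1)$ and $\beta>-1$, let $\Xi_n$ be the position at time $n$ of the laziest elephant random walk with power law memory with parameters $(p,\beta)$, and let $\Xi_\infty=\lim_{n\to\infty}\Xi_n\in\mathbb{N}\cup\{+\infty\}$. (i) If $-1<\beta<p/(1-p)$, then $E[\Xi_n]\sim C(p,\beta)\cdot n^{p(\beta+1)-\beta}$ as $n\to\infty$, where $$C(p,\beta):=\frac{1}{p(\beta+1)-\beta}\cdot\frac{\Gamma(\beta+1)}{\Gamma(p(\beta+1))}.$$ (ii) If $\beta=p/(1-p)$, then $E[\Xi_n]\sim\beta\log n$ as $n\to\infty$. (iii) If $\beta>p/(1-p)$, then $$E[\Xi_\infty]=\lim_{n\to\infty}E[\Xi_n]=\frac{\beta}{\beta-p(\beta+1)}.$$ In particular, $\Xi_\infty<+\infty$ almost surely.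
   Context: For $\xi>-1$ and $n\in\mathbb{N}=\{1,2,\dots\}$ put $c_n(\xi):=\dfrac{\Gamma(n+\xi)}{\Gamma(n)\Gamma(\xi+1)}$, and $\mu_n:=c_n(\beta)$. Laziest elephant random walk with power law memory, with parameters $p\in(0,1)$, $\beta>-1$: let $\{\beta_{n+1}:n\in\mathbb{N}\}$ be independent random variables with $$P(\beta_{n+1}=k)=\frac{\beta+1}{n}\cdot\frac{\mu_k}{\mu_{n+1}}\quad (1\le k\le n),$$ and $P(\beta_{n+1}=k)=0$ otherwise (this is a probability mass function). Set $X_1\equiv 1$ and, for $n\ge 1$, $X_{n+1}=X_{\beta_{n+1}}$ with probability $p$ and $X_{n+1}=0$ with probability $1-p$; that is, $X_{n+1}=\alpha_{n+1}X_{\beta_{n+1}}$, where the $\alpha_{n+1}$ are i.i.d. Bernoulli($p$) random variables independent of $\{\beta_{n+1}\}$. The walk is $\Xi_0=0$, $\Xi_n=\sum_{k=1}^n X_k$. Here $a_n\sim b_n$ means $a_n/b_n\to1$. *)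

(* Defs.v *)
From HB Require Import structures.
From mathcomp Require Import all_boot all_order all_algebra finmap.
From mathcomp Require Import all_classical all_reals all_analysis.

Set Implicit Arguments.
Unset Strict Implicit.
Unset Printing Implicit Defensive.

Import Order.TTheory GRing.Theory Num.Theory.
Import numFieldNormedType.Exports.

Local Open Scope classical_set_scope.
Local Open Scope ring_scope.

(* Euler's integral: this is the Gamma function only for x > 0. *)
Definition Gamma {R : realType} (x : R) : R :=
  \int[lebesgue_measure]_(t in `]0, +oo[) (t `^ (x - 1) * expR (- t)).

Definition c_ {R : realType} (n : nat) (xi : R) : R :=
  Gamma (n%:R + xi) / (Gamma n%:R * Gamma (xi + 1)).

Definition asymp_equiv {R : realType} (a b : nat -> R) : Prop :=
  (a n / b n) @[n --> \oo] --> (1 : R).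

Definition mutually_independent {d d'} {T : measurableType d}
    {T' : measurableType d'} {R : realType} (P : probability T R)
    {I : choiceType} (D : set I) (Y : I -> {RV P >-> T'}) : Prop :=
  forall (J : {fset I}) (B : I -> set T'),
    [set` J] `<=` D -> (forall i, measurable (B i)) ->
    P (\bigcap_(i in [set` J]) (Y i @^-1` B i)) =
      (\prod_(i <- J) P (Y i @^-1` B i))%E.

Definition sigma_generated {d d'} {T : measurableType d}
    {T' : measurableType d'} {R : realType} (P : probability T R)
    {I : choiceType} (D : set I) (Y : I -> {RV P >-> T'}) : set (set T) :=
  <<s \bigcup_(i in D) preimage_set_system setT (Y i) measurable >>.

Definition independent_families {d d1 d2} {T : measurableType d}
    {T1 : measurableType d1} {T2 : measurableType d2} {R : realType}
    (P : probability T R) {I : choiceType} (D : set I)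
    (Y : I -> {RV P >-> T1}) (Z : I -> {RV P >-> T2}) : Prop :=
  forall A B : set T, sigma_generated D Y A -> sigma_generated D Z B ->
    P (A `&` B) = (P A * P B)%E.

(* The variables alpha k and beta k are only meaningful for k >= 2, and X k for
   k >= 1; values at smaller indices are unconstrained and never used (almost
   surely). The value true of alpha k stands for 1. *)
Record laziest_erw {d} {T : measurableType d} {R : realType}
    (P : probability T R) (p b : R) (alpha : nat -> {RV P >-> bool})
    (beta X : nat -> {RV P >-> nat}) : Prop := LaziestERW {
  erw_beta_indep : mutually_independent [set k | (2 <= k)%N] beta ;
  erw_beta_pmf : forall n k, (1 <= n)%N ->
    P (beta n.+1 @^-1` [set k]) =
      (if (1 <= k <= n)%N then (b + 1) / n%:R * (c_ k b / c_ n.+1 b)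
       else 0)%:E ;
  erw_alpha_indep : mutually_independent [set k | (2 <= k)%N] alpha ;
  erw_alpha_law : forall n A, (1 <= n)%N ->
    distribution P (alpha n.+1) A = bernoulli_prob p A ;
  erw_alpha_beta_indep : independent_families [set k | (2 <= k)%N] alpha beta ;
  erw_X1 : forall w, X 1%N w = 1%N ;
  erw_XS : forall n w, (1 <= n)%N ->
    X n.+1 w = (alpha n.+1 w * X (beta n.+1 w) w)%N
}.

Definition Xi {T : Type} (X : nat -> T -> nat) (n : nat) (w : T) : nat :=
  (\sum_(1 <= k < n.+1) X k w)%N.

Definition Xi_infty {T : Type} (R : realType) (X : nat -> T -> nat) (w : T) :
    \bar R :=
  limn (fun n => (Xi X n w)%:R%:E).

(* The limit exists for every outcome because the steps are nonnegative. *)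
Lemma Xi_cvg {T : Type} (R : realType) (X : nat -> T -> nat) (w : T) :
  (Xi X n w)%:R%:E @[n --> \oo] --> Xi_infty R X w.
Proof.
apply: ereal_nondecreasing_is_cvgn; apply/nondecreasing_seqP => n.
by rewrite lee_fin ler_nat /Xi [leqRHS]big_nat_recr //= leq_addr.
Qed.

Definition C_const {R : realType} (p b : R) : R :=
  1 / (p * (b + 1) - b) * (Gamma (b + 1) / Gamma (p * (b + 1))).

(* Main.v *)
From HB Require Import structures.
Require Import Defs.
From mathcomp Require Import all_boot all_order all_algebra finmap.
From mathcomp Require Import all_classical all_reals all_analysis.
From mathcomp Require Import measurable_realfun.
From mathcomp Require Import ring lra.

Import Order.TTheory GRing.Theory Num.Theory.
Import numFieldNormedType.Exports.

Local Open Scope classical_set_scope.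
Local Open Scope ring_scope.

Set Implicit Arguments.
Unset Strict Implicit.
Unset Printing Implicit Defensive.

(** Put q = p (b + 1).  Conditioning on the memory variable beta_(n+1) gives
    the linear recursion
<<
      E X_(n+1) = p * sum_(1 <= k <= n) P(beta_(n+1) = k) * E X_k ,
>>
    and, since P(beta_(n+1) = k) = (b + 1)/n * mu_k / mu_(n+1), its solution is
<<
      E X_(n+1) = Gamma(b+1)/Gamma(q) * Gamma(n+q)/Gamma(n+1+b)
>>
    ([mean_step] below).  The relation (n+1+b) E X_(n+2) = (n+q) E X_(n+1)
    makes the sum telescope:
<<
      (q - b) * E Xi_n = (n + b) * E X_(n+1) - b ,
>>
    where (n + b) E X_(n+1) is a constant times Gamma(n+q)/Gamma(n+b), which is
    asymptotic to n^(q-b).  The sign of q - b = p (b+1) - b, which is also the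
    sign of p/(1-p) - b, decides between the three regimes: growth like
    n^(q-b), harmonic sums when q = b, and a finite limit when q < b.  In the
    last regime monotone convergence turns the limit of the means into the mean
    of the limit, whose finiteness gives almost sure finiteness.

    Two points need work.

    The recursion requires that X_k be independent of the later variables
    alpha_j, beta_j.  Unfolding X_k backwards along its chain of memories only
    produces events of the form alpha_j = 1 and beta_j = v_j for j in a finite
    set J, called trails here, and their probabilities are products by
    independence.  Strong induction on k then yields the integral of X_k over
    any trail that involves only times later than k
    ([integral_trail_step]), which is all that the recursion needs.

    The Gamma function is handled straight from Euler's integral.
    Integration by parts gives the functional equation, and integrating the
    tangent-line inequality for t^s gives Gamma(x+s) <= x^s Gamma(x) for
    0 <= s <= 1.  These two facts squeeze Gamma(n+s) / (Gamma(n) n^s) to 1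
    ([cvg_gamma_ratio]). *)

(** * Logarithms and powers *)

Section powers.
Context {R : realType}.
Implicit Types (x c t s : R) (n : nat).

Lemma cvgr_ln : ln (n%:R : R) @[n --> \oo] --> +oo.
Proof.
apply/cvgryPge => A; near=> n.
rewrite -(expRK A) ler_ln ?posrE ?expR_gt0//; last first.
  by rewrite (lt_le_trans (expR_gt0 A))//; near: n; exact: nbhs_infty_ger.
by near: n; exact: nbhs_infty_ger.
Unshelve. all: by end_near. Qed.

Lemma cvgr_powRn_neg c : c < 0 -> (n%:R : R) `^ c @[n --> \oo] --> 0.
Proof.
move=> c0; apply/cvgrPdist_le => e e0; near=> n.
have n0 : 0 < (n%:R : R) by rewrite ltr0n; near: n; exact: nbhs_infty_gt.
rewrite sub0r normrN ger0_norm ?powR_ge0// /powR gt_eqF//.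
rewrite -[leRHS]lnK ?posrE// ler_expR.
rewrite -ler_ndivrMl// mulrC; near: n.
by move/cvgryPge : cvgr_ln; exact.
Unshelve. all: by end_near. Qed.

(** From ln u < u at u = n/(x+1), one gets n^(x+1) <= (x+1)^(x+1) e^n, so that
    the product is O(1/n). *)
Lemma cvgr_powRn_expRN x : 0 < x ->
  (n.+1%:R : R) `^ x * expR (- n.+1%:R) @[n --> \oo] --> 0.
Proof.
move=> x0.
apply: (@squeeze_cvgr _ _ _ _ (cst 0)
  (fun n => (x + 1) `^ (x + 1) * harmonic n)).
- apply: nearW => n; rewrite mulr_ge0 ?powR_ge0 ?expR_ge0//=.
  have n0 : 0 < (n.+1%:R : R) by rewrite ltr0n.
  have x1 : 0 < x + 1 by rewrite addr_gt0.
  rewrite ler_pdivlMr// mulrAC -{2}(powRr1 (ltW n0)) -powRD; last first.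
    by rewrite gt_eqF ?implybT.
  rewrite expRN ler_pdivrMr ?expR_gt0// /powR !gt_eqF// -expRD ler_expR.
  have := ln_sublinear (divr_gt0 n0 x1).
  rewrite ln_div ?posrE// ltrBlDr => /ltW.
  rewrite -(ler_pM2l x1) mulrDr => /le_trans; apply.
  by rewrite mulrCA divff ?gt_eqF// mulr1 addrC.
- exact: cvg_cst.
- rewrite -[X in _ --> X](mulr0 ((x + 1) `^ (x + 1))).
  by apply: cvgMr; exact: cvg_harmonic.
Unshelve. all: by end_near. Qed.

(** The concave function t |-> t^s lies below its tangent at c.  Integrated
    against a Gamma density, this does the work that Hoelder's inequality does in
    the usual proof of Gamma(x+s) <= x^s Gamma(x). *)
Lemma powR_le_tangent c t s : 0 < c -> 0 < t -> 0 <= s <= 1 ->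
  t `^ s <= c `^ s * (1 - s + s * (t / c)).
Proof.
move=> c0 t0 /andP[s0 s1].
have tc : 0 < t / c by rewrite divr_gt0.
rewrite -[X in X `^ s <= _](divfK (lt0r_neq0 c0)) (mulrC _ c).
rewrite powRM ?(ltW c0) ?(ltW tc)//.
rewrite ler_pM2l ?powR_gt0//.
move: (t / c) tc => z z0.
have := convex_expR (Itv01 s0 s1) (ln z) 0.
rewrite !convRE/= mulr0 addr0 expR0 mulr1 lnK ?posrE// /powR gt_eqF//.
by rewrite /unstable.onem addrC.
Qed.

End powers.

(** * Euler's integral and its functional equation *)

(** A locked copy of the Gamma function: without the lock, unification unfolds
    Gamma into an integral whenever two of its values are compared. *)
HB.lock Definition gamma {R : realType} (x : R) : R := Gamma x.

Lemma GammaE {R : realType} : Gamma = gamma :> (R -> R).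
Proof. by rewrite unlock. Qed.

Section gamma.
Context {R : realType}.
Notation mu := lebesgue_measure.
Implicit Types (c x s t : R) (n : nat).

Definition gamma_integrand x t : R := t `^ (x - 1) * expR (- t).

(** Euler's integral before truncation to a real number: identities between
    integrals of nonnegative functions hold here without any integrability
    condition, and finiteness is deduced from them afterwards. *)
Definition egamma x : \bar R :=
  (\int[mu]_(t in `]0%R, +oo[) (gamma_integrand x t)%:E)%E.

Lemma gamma_integrand_ge0 x t : 0 <= gamma_integrand x t.
Proof. by rewrite mulr_ge0 ?powR_ge0 ?expR_ge0. Qed.

Lemma measurable_gamma_integrand x D : measurable_fun D (gamma_integrand x).
Proof.
apply: measurable_funTS; apply: measurable_funM; first exact: measurable_powR.
by apply: measurableT_comp => //; exact: measurable_funN.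
Qed.

Lemma measurable_egamma_integrand x D :
  measurable_fun D (fun t => (gamma_integrand x t)%:E).
Proof. by apply/measurable_EFinP; exact: measurable_gamma_integrand. Qed.

(** Compact subintervals that stay away from the singularity at 0, so that
    integration by parts on a segment applies.  The shift by 2 makes even the
    first one nondegenerate. *)
Definition exhaust n : set R := `[n.+2%:R^-1, n.+2%:R]%classic.

Lemma bigcup_exhaust : \bigcup_n exhaust n = `]0, +oo[%classic.
Proof.
apply/seteqP; split => t /=.
  move=> [n _]; rewrite /exhaust /= !in_itv/= andbT => /andP[+ _].
  by apply: lt_le_trans; rewrite invr_gt0 ltr0n.
rewrite in_itv/= andbT => t0.
exists (maxn (Num.truncn t) (Num.truncn t^-1)) => //.
rewrite /exhaust/= in_itv/=; apply/andP; split.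
  rewrite -[leRHS]invrK lef_pV2 ?posrE ?invr_gt0 ?ltr0n//.
  rewrite (le_trans (ltW (truncnS_gt _)))// ler_nat.
  by rewrite -addn2 -addn1 leq_add// leq_maxr.
rewrite (le_trans (ltW (truncnS_gt _)))// ler_nat.
by rewrite -addn2 -addn1 leq_add// leq_maxl.
Qed.

Lemma cvg_integral_exhaust x :
  (\int[mu]_(t in exhaust n) (gamma_integrand x t)%:E)%E @[n --> \oo] -->
  egamma x.
Proof.
rewrite /egamma -bigcup_exhaust.
apply: ge0_nondecreasing_set_cvg_integral.
- move=> m n mn; apply/subsetPset; apply: subset_itv; rewrite bnd_simp.
    by rewrite lef_pV2 ?posrE ?ltr0n// ler_nat !ltnS.
  by rewrite ler_nat !ltnS.
- by move=> n; exact: measurable_itv.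
- by move=> n; exact: measurable_egamma_integrand.
- by move=> n t _; rewrite lee_fin gamma_integrand_ge0.
Qed.

Let ltab n : (n.+2%:R^-1 : R) < n.+2%:R.
Proof. by rewrite (@le_lt_trans _ _ 1)// ?invf_le1 ?ltr0n ?ler1n// ltr1n. Qed.

Lemma continuous_powR x t : 0 < t -> {for t, continuous (fun u : R => u `^ x)}.
Proof.
move=> t0; apply: differentiable_continuous; apply/derivable1_diffP.
by apply: derivable_powR; rewrite in_itv/= andbT.
Qed.

Lemma integral_exhaustD1 x n : 0 < x ->
  (\int[mu]_(t in exhaust n) (gamma_integrand (x + 1) t)%:E =
   (n.+2%:R^-1 `^ x * expR (- n.+2%:R^-1)
     - n.+2%:R `^ x * expR (- n.+2%:R))%:E +
   x%:E * \int[mu]_(t in exhaust n) (gamma_integrand x t)%:E)%E.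
Proof.
move=> x0; pose a : R := n.+2%:R^-1; pose b : R := n.+2%:R.
have a0 : 0 < a by rewrite invr_gt0 ltr0n.
have pos t : t \in `[a, b] -> 0 < t.
  by rewrite in_itv/= => /andP[/(lt_le_trans a0)].
have poso t : t \in `]a, b[ -> 0 < t.
  by rewrite in_itv/= => /andP[/(lt_trans a0)].
have b0 : 0 < b by rewrite ltr0n.
have cE : continuous (fun t : R => expR (- t)).
  move=> t; apply: continuous_comp; first exact: opp_continuous.
  exact: continuous_expR.
have := @integration_by_parts R (fun t => t `^ x) (fun t => - expR (- t))
  (fun t => x * t `^ (x - 1)) (fun t => expR (- t)) a b (ltab n).
move=> /(_ _ _ _ _ _ _)/wrap[].
- apply: continuous_in_subspaceT => t; rewrite inE => /pos t0.
  by apply: cvgM; [exact: cvg_cst|exact: continuous_powR].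
- split.
  + by move=> t /poso t0; apply: derivable_powR; rewrite in_itv/= andbT.
  + by apply: cvg_at_right_filter; exact: continuous_powR.
  + by apply: cvg_at_left_filter; exact: continuous_powR.
- by move=> t /poso t0; rewrite powR_derive1// in_itv/= andbT.
- by apply: continuous_subspaceT => t; exact: cE.
- split.
  + by move=> t _; exact: ex_derive.
  + by apply: cvg_at_right_filter; apply: cvgN; exact: cE.
  + by apply: cvg_at_left_filter; apply: cvgN; exact: cE.
- move=> t _; rewrite derive1E derive_val/=.
  by rewrite mulrN1 opprK.
rewrite /exhaust -/a -/b.
rewrite [X in (_ - X)%E](_ : _ =
    - (x%:E * \int[mu]_(t in `[a, b]) (gamma_integrand x t)%:E))%E; last first.
  rewrite -ge0_integralZl_EFin//=; last 3 first.
  - by move=> t _; rewrite lee_fin gamma_integrand_ge0.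
  - exact: measurable_egamma_integrand.
  - exact: ltW.
  rewrite -integral_ge0N; last first.
    by move=> t _; rewrite -EFinM lee_fin mulr_ge0 ?gamma_integrand_ge0// ltW.
  by apply: eq_integral => t _; rewrite mulrN EFinN -mulrA EFinM.
rewrite oppeK !mulrN opprK (addrC (- _)) => <-.
by apply: eq_integral => t _; rewrite /gamma_integrand addrK.
Qed.

(** Integrate t^x e^(-t) by parts on the segments [1/n, n]: both boundary
    terms vanish in the limit. *)
Lemma egammaD1 x : 0 < x -> egamma (x + 1) = (x%:E * egamma x)%E.
Proof.
move=> x0; have lhs := @cvg_integral_exhaust (x + 1).
suff rhs : (\int[mu]_(t in exhaust n) (gamma_integrand (x + 1) t)%:E)%E
    @[n --> \oo] --> (0%:E + x%:E * egamma x)%E.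
  by rewrite -[RHS]add0e -(cvg_lim _ rhs)// (cvg_lim _ lhs).
under eq_cvg do rewrite integral_exhaustD1//.
apply: cvgeD => //.
- apply: cvg_EFin; first exact: nearW.
  rewrite /= -[X in _ --> X](subrr 0); apply: cvgB.
  + apply: (@squeeze_cvgr _ _ _ _ (cst 0) (fun n => n.+2%:R `^ (- x))).
    * apply: nearW => n; rewrite mulr_ge0 ?powR_ge0 ?expR_ge0//=.
      have -> : (n.+2%:R^-1 : R) `^ x = n.+2%:R `^ (- x).
        by rewrite -powR_inv1 ?ler0n// -powRrM mulN1r.
      by rewrite ler_piMr ?powR_ge0// -expR0 ler_expR oppr_le0 invr_ge0.
    * exact: cvg_cst.
    * rewrite (_ : (fun n => _) = (fun n => (n + 2)%:R `^ (- x))); last first.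
        by apply/funext => n; rewrite addn2.
      rewrite (cvg_shiftn 2 (fun n => n%:R `^ (- x))).
      by apply: cvgr_powRn_neg; rewrite oppr_lt0.
  + rewrite (cvg_shiftS (fun n => n.+1%:R `^ x * expR (- n.+1%:R))).
    exact: cvgr_powRn_expRN.
- by apply: cvgeZl => //; exact: cvg_integral_exhaust.
Qed.

Lemma egamma_ge0 x : (0 <= egamma x)%E.
Proof. by apply: integral_ge0 => t _; rewrite lee_fin gamma_integrand_ge0. Qed.

Lemma egamma1 : egamma 1 = 1%E.
Proof.
rewrite /egamma integral_itv_obnd_cbnd; last exact: measurable_egamma_integrand.
under eq_integral do rewrite /gamma_integrand subrr powRr0 mul1r.
have cE : continuous (fun t : R => expR (- t)).
  move=> t; apply: continuous_comp; first exact: opp_continuous.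
  exact: continuous_expR.
rewrite (@ge0_continuous_FTC2y _ _ (fun t => - expR (- t)) 0 0).
- by rewrite oppr0 expR0 EFinN oppeK add0e.
- by move=> t _; exact: expR_ge0.
- by apply: continuous_subspaceT => t; exact: cE.
- by rewrite -oppr0; apply: cvgN; exact: cvgr_expR.
- by move=> t _; exact: ex_derive.
- by apply: cvg_at_right_filter; apply: cvgN; exact: cE.
- by move=> t _; rewrite derive1E derive_val/= mulrN1 opprK.
Qed.

Lemma egammaD_le c x s : 0 < c -> 0 <= s <= 1 ->
  (egamma (x + s) <= (c `^ s * (1 - s))%:E * egamma x
                     + (c `^ s * (s / c))%:E * egamma (x + 1))%E.
Proof.
move=> c0 s01; have /andP[s0 s1] := s01.
have k1 : 0 <= c `^ s * (1 - s) by rewrite mulr_ge0 ?powR_ge0 ?subr_ge0.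
have k2 : 0 <= c `^ s * (s / c).
  by rewrite mulr_ge0 ?powR_ge0 ?divr_ge0 ?(ltW c0).
rewrite /egamma -!ge0_integralZl_EFin//; last 4 first.
- by move=> t _; rewrite lee_fin gamma_integrand_ge0.
- exact: measurable_egamma_integrand.
- by move=> t _; rewrite lee_fin gamma_integrand_ge0.
- exact: measurable_egamma_integrand.
have pos y k t : 0 <= k -> (0 <= k%:E * (gamma_integrand y t)%:E)%E.
  by move=> k0; apply: mule_ge0; rewrite lee_fin// gamma_integrand_ge0.
have meas y k D :
    measurable_fun D (fun t => (k%:E * (gamma_integrand y t)%:E)%E).
  apply/measurable_EFinP; apply: measurable_funM => //.
  exact: measurable_gamma_integrand.
rewrite -ge0_integralD//; last 4 first.
- by move=> t _; exact: pos.
- exact: meas.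
- by move=> t _; exact: pos.
- exact: meas.
apply: ge0_le_integral => //.
- by move=> t _; rewrite lee_fin gamma_integrand_ge0.
- exact: measurable_egamma_integrand.
- by apply: emeasurable_funD; exact: meas.
move=> t /=; rewrite in_itv/= andbT => t0.
rewrite -!EFinM -EFinD lee_fin /gamma_integrand addrK.
have -> : x + s - 1 = s + (x - 1) by ring.
have E : t `^ x = t * t `^ (x - 1).
  by rewrite -{2}(powRr1 (ltW t0)) -powRD ?subrKC// (gt_eqF t0) implybT.
rewrite E powRD ?(gt_eqF t0) ?implybT//.
have := powR_le_tangent c0 t0 s01.
move/(ler_wpM2r (gamma_integrand_ge0 x t)); rewrite /gamma_integrand.
congr (_ <= _); last by field; rewrite gt_eqF.
by rewrite mulrA.
Qed.

(** The value at 1 and the functional equation give finiteness at positive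
    integers, [egammaD_le] interpolates between them, and the functional
    equation read backwards reaches the interval from 0 to 1. *)
Lemma egamma_lty x : 0 < x -> (egamma x < +oo)%E.
Proof.
move=> x0.
have egN n : (egamma n.+1%:R < +oo)%E.
  elim: n => [|n IH]; first by rewrite egamma1 ltry.
  by rewrite -natr1 egammaD1// lte_mul_pinfty.
suff : (egamma (x + 1) < +oo)%E.
  rewrite egammaD1//.
  case: (egamma x) (egamma_ge0 x) => [r _ _|_|]; rewrite ?ltry//.
  by rewrite gt0_muley ?lte_fin.
pose n := Num.truncn x; have /andP[nx xn] := truncn_itv (ltW x0).
have -> : x + 1 = n.+1%:R + (x - n%:R) by rewrite -natr1; ring.
apply: (le_lt_trans (@egammaD_le 1 _ _ _ _)) => //.
  by rewrite subr_ge0 nx lerBlDl natr1 ltW.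
rewrite natr1 powR1 !mul1r divr1 lte_add_pinfty// lte_mul_pinfty// lee_fin.
  by rewrite subr_ge0 lerBlDl natr1 ltW.
by rewrite subr_ge0.
Qed.

Lemma EFin_gamma x : 0 < x -> (gamma x)%:E = egamma x.
Proof.
move=> x0; rewrite -GammaE /Gamma /Rintegral fineK//.
rewrite ge0_fin_numE ?egamma_ge0//; exact: egamma_lty.
Qed.

Lemma gammaD1 x : 0 < x -> gamma (x + 1) = x * gamma x.
Proof.
move=> x0; apply: EFin_inj.
by rewrite EFinM !EFin_gamma// ?egammaD1// addr_gt0.
Qed.

(** By the functional equation it suffices to look at x + 1, whose integrand is
    at least e^(-2) on [1, 2]. *)
Lemma gamma_gt0 x : 0 < x -> 0 < gamma x.
Proof.
move=> x0; suff: 0 < gamma (x + 1) by rewrite gammaD1// pmulr_rgt0.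
rewrite -lte_fin EFin_gamma ?addr_gt0//.
apply: (@lt_le_trans _ _ (\int[mu]_(t in `[1%R, 2%R]) (expR (- 2))%:E)%E).
  rewrite integral_cst//= lebesgue_measure_itv/= lte_fin ltr1n.
  by rewrite -EFinD -EFinM lte_fin mulr_gt0 ?expR_gt0// subr_gt0 ltr1n.
apply: (@le_trans _ _
  (\int[mu]_(t in `[1%R, 2%R]) (gamma_integrand (x + 1) t)%:E)%E).
  apply: ge0_le_integral => //=.
  - exact: measurable_egamma_integrand.
  move=> t; rewrite in_itv/= => /andP[t1 t2].
  rewrite lee_fin /gamma_integrand addrK.
  apply: (@le_trans _ _ (expR (- t))); first by rewrite ler_expR lerN2.
  rewrite ler_peMl ?expR_ge0//.
  have -> : 1 = 1 `^ x :> R by rewrite powR1.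
  by rewrite ge0_ler_powR ?nnegrE ?(ltW x0)// (le_trans _ t1).
apply: ge0_subset_integral => //=.
- exact: measurable_egamma_integrand.
- by move=> t _; rewrite lee_fin gamma_integrand_ge0.
- move=> t /=; rewrite !in_itv/= andbT => /andP[t1 _].
  by rewrite (lt_le_trans _ t1).
Qed.

(** Choosing the tangent point c = x in [egammaD_le] makes its right-hand side
    collapse by the functional equation. *)
Lemma gammaD_le x s : 0 < x -> 0 <= s <= 1 -> gamma (x + s) <= x `^ s * gamma x.
Proof.
move=> x0 s01; have /andP[s0 s1] := s01.
have := egammaD_le x x0 s01.
rewrite egammaD1// -!EFin_gamma// ?ltr_wpDr// -!EFinM -EFinD lee_fin.
move=> /le_trans; apply; rewrite le_eqVlt; apply/orP; left; apply/eqP.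
by field; rewrite gt_eqF.
Qed.

End gamma.

(** * Asymptotics of quotients of Gamma values *)

Section gamma_asymptotics.
Context {R : realType}.
Implicit Types (q b s : R) (n : nat).

Lemma eventually_eq_cvg (u v : nat -> R) (l : R) :
  (\forall n \near \oo, u n = v n) -> u n @[n --> \oo] --> l ->
  v n @[n --> \oo] --> l.
Proof. by move=> uv; apply: cvg_trans; exact: near_eq_cvg. Qed.

Lemma cvg_shift_ratio s : (n%:R + s) / n%:R @[n --> \oo] --> (1 : R).
Proof.
have : 1 + s * n%:R^-1 @[n --> \oo] --> (1 + s * 0 : R).
  apply: cvgD; first exact: cvg_cst.
  apply: cvgMr; rewrite -cvg_shiftS; exact: cvg_harmonic.
rewrite mulr0 addr0; apply: eventually_eq_cvg; near=> n.
have n0 : (n%:R : R) != 0.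
  by rewrite pnatr_eq0 -lt0n; near: n; exact: nbhs_infty_gt.
by rewrite mulrDl divff.
Unshelve. all: by end_near. Qed.

(** The upper bound is [gammaD_le] at x = n.  The lower bound is the same
    inequality at x = n + s with increment 1 - s, which leads from n + s to
    n + 1; it bounds the ratio below by (n/(n+s))^(1-s) >= n/(n+s). *)
Lemma cvg_gamma_ratio01 s : 0 <= s <= 1 ->
  gamma (n%:R + s) / (gamma n%:R * n%:R `^ s) @[n --> \oo] --> (1 : R).
Proof.
move=> s01; have /andP[s0 s1] := s01.
apply: (@squeeze_cvgr _ _ _ _
  (fun n => ((n%:R + s) / n%:R)^-1) (cst 1)); last 2 first.
- rewrite -[X in _ --> X]invr1; apply: cvgV; rewrite ?oner_neq0//.
  exact: cvg_shift_ratio.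
- exact: cvg_cst.
near=> n.
have n0 : 0 < (n%:R : R) by rewrite ltr0n; near: n; exact: nbhs_infty_gt.
have G0 := gamma_gt0 n0.
have P0 : 0 < (n%:R : R) `^ s by rewrite powR_gt0.
have ns0 : 0 < n%:R + s by rewrite ltr_wpDr.
apply/andP; split; last first.
  by rewrite ler_pdivrMr ?mulr_gt0// mul1r mulrC gammaD_le.
have s01' : 0 <= 1 - s <= 1 by rewrite subr_ge0 s1 lerBlDr lerDl.
have := gammaD_le ns0 s01'.
rewrite (_ : n%:R + s + (1 - s) = n%:R + 1); last by ring.
rewrite gammaD1// => H.
rewrite ler_pdivlMr ?mulr_gt0//.
have Hz : n%:R / (n%:R + s) <= (n%:R / (n%:R + s)) `^ (1 - s) :> R.
  apply: ger1_powR; last by case/andP: s01'.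
  by rewrite divr_gt0//= ler_pdivrMr// mul1r lerDl.
rewrite invf_div.
apply: (@le_trans _ _
  ((n%:R / (n%:R + s)) `^ (1 - s) * (gamma n%:R * n%:R `^ s))).
  by rewrite ler_pM2r ?mulr_gt0.
rewrite powRM ?invr_ge0 ?(ltW n0) ?(ltW ns0)//.
rewrite -powR_inv1 ?(ltW ns0)// powRAC powR_inv1 ?powR_ge0//.
rewrite mulrAC ler_pdivrMr ?powR_gt0// mulrC [leRHS]mulrC.
apply: le_trans H.
rewrite -mulrA -powRD ?(gt_eqF n0) ?implybT// subrKC powRr1 ?(ltW n0)//.
by rewrite mulrC.
Unshelve. all: by end_near. Qed.

Lemma cvg_gamma_ratio s : 0 <= s ->
  gamma (n%:R + s) / (gamma n%:R * n%:R `^ s) @[n --> \oo] --> (1 : R).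
Proof.
move=> s0; have /andP[ks sk] := truncn_itv s0.
pose r := s - (Num.truncn s)%:R.
have r01 : 0 <= r <= 1 by rewrite subr_ge0 ks lerBlDl natr1 ltW.
have {ks sk} -> : s = r + (Num.truncn s)%:R by rewrite subrK.
have r0 : 0 <= r by case/andP: r01.
elim: (Num.truncn s) => [|k IH].
  by rewrite addr0; exact: cvg_gamma_ratio01.
have /(_ _) := cvgM (cvg_shift_ratio (r + k%:R)) IH.
rewrite mulr1; apply: eventually_eq_cvg; near=> n; rewrite /=.
have n0 : 0 < (n%:R : R) by rewrite ltr0n; near: n; exact: nbhs_infty_gt.
have ns0 : 0 < n%:R + (r + k%:R).
  by rewrite ltr_wpDr// addr_ge0// ler0n.
have -> : n%:R + (r + k.+1%:R) = n%:R + (r + k%:R) + 1 :> R.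
  by rewrite -natr1; ring.
have -> : r + k.+1%:R = (r + k%:R) + 1 by rewrite -natr1; ring.
rewrite gammaD1// (@powRD _ _ (r + k%:R) 1) ?(gt_eqF n0) ?implybT//.
rewrite powRr1 ?(ltW n0)//.
field; rewrite !gt_eqF ?powR_gt0 ?gamma_gt0//.
Unshelve. all: by end_near. Qed.

(** Since b may be negative, the ratio is compared at b + 1 >= 0 and brought
    back by the functional equation. *)
Lemma cvg_gamma_quot q b : 0 <= q -> -1 < b ->
  gamma (n%:R + q) / gamma (n%:R + b) / n%:R `^ (q - b) @[n --> \oo]
    --> (1 : R).
Proof.
move=> q0 b1; have b10 : 0 <= b + 1 by lra.
have /(_ _) inv_b := cvgV (@oner_neq0 R) (cvg_gamma_ratio b10).
have /(_ _) q_over_b := cvgM (cvg_gamma_ratio q0) inv_b.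
have /(_ _) := cvgM q_over_b (cvg_shift_ratio b).
rewrite invr1 !mulr1; apply: eventually_eq_cvg; near=> n; rewrite /=.
have n1 : 1 <= (n%:R : R) by rewrite ler1n; near: n; exact: nbhs_infty_gt.
have n0 : 0 < (n%:R : R) by lra.
have nb0 : 0 < n%:R + b by lra.
rewrite addrA gammaD1// powRB ?(gt_eqF n0) ?implybT//.
rewrite (@powRD _ _ b 1) ?(gt_eqF n0) ?implybT//.
rewrite powRr1 ?(ltW n0)//.
field; rewrite !gt_eqF ?powR_gt0 ?gamma_gt0//.
Unshelve. all: by end_near. Qed.

End gamma_asymptotics.

(** * The mean increments and their partial sums *)

Section mean_step.
Context {R : realType}.
Implicit Types (q b p : R) (n : nat).

(** The expectation of the (n+1)-st step X_(n+1), when q = p (b + 1). *)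
Definition mean_step b q n : R :=
  gamma (b + 1) / gamma q * (gamma (n%:R + q) / gamma (n.+1%:R + b)).

Lemma c_S b n : -1 < b -> n.+1%:R * c_ n.+2 b = (n.+1%:R + b) * c_ n.+1 b.
Proof.
move=> b1; have n1 : 1 <= (n.+1%:R : R) by rewrite ler1n.
have nb0 : 0 < n.+1%:R + b by lra.
have b10 : 0 < b + 1 by lra.
have n0 : 0 < (n.+1%:R : R) by rewrite ltr0n.
rewrite /c_ GammaE -(natr1 n.+1).
have -> : n.+1%:R + 1 + b = n.+1%:R + b + 1 by ring.
rewrite (gammaD1 n0) (gammaD1 nb0).
by field; rewrite ?gt_eqF ?gamma_gt0//.
Qed.

Lemma c_gt0 b n : -1 < b -> (0 < n)%N -> 0 < c_ n b.
Proof.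
move=> b1 n0; have n1 : 1 <= (n%:R : R) by rewrite ler1n.
by rewrite /c_ GammaE divr_gt0 ?mulr_gt0 ?gamma_gt0//; lra.
Qed.

Lemma mean_step0 b q : -1 < b -> 0 < q -> mean_step b q 0 = 1.
Proof.
move=> b1 q0; rewrite /mean_step add0r (addrC 1 b).
have b10 : 0 < b + 1 by lra.
by field; rewrite ?gt_eqF ?gamma_gt0//.
Qed.

Lemma mean_stepS b q n : -1 < b -> 0 < q ->
  (n.+1%:R + b) * mean_step b q n.+1 = (n%:R + q) * mean_step b q n.
Proof.
move=> b1 q0; have n0 : 0 <= (n%:R : R) by rewrite ler0n.
have nq0 : 0 < n%:R + q by lra.
have nb0 : 0 < n.+1%:R + b by rewrite -natr1; lra.
rewrite /mean_step.
have -> : n.+2%:R + b = n.+1%:R + b + 1 by rewrite -natr1; ring.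
have -> : n.+1%:R + q = n%:R + q + 1 by rewrite -natr1; ring.
rewrite (gammaD1 nq0) (gammaD1 nb0).
by field; rewrite ?gt_eqF ?gamma_gt0//; lra.
Qed.

(** Both sides satisfy the same recursion in n, because
    (n+1) c_(n+2) = (n+1+b) c_(n+1) while the mean steps have ratio
    (n+q)/(n+1+b). *)
Lemma sum_c_mean_step b q n : -1 < b -> 0 < q ->
  q * \sum_(1 <= k < n.+1) c_ k b * mean_step b q k.-1
  = n%:R * c_ n.+1 b * mean_step b q n.
Proof.
move=> b1 q0; elim: n => [|n IH]; first by rewrite big_geq// mulr0 !mul0r.
rewrite big_nat_recr//= mulrDr IH c_S//.
rewrite [RHS]mulrAC mean_stepS//; ring.
Qed.

Lemma mean_step_rec b p n : -1 < b -> 0 < p -> (0 < n)%N ->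
  \sum_(1 <= k < n.+1) p * ((b + 1) / n%:R * (c_ k b / c_ n.+1 b))
     * mean_step b (p * (b + 1)) k.-1
  = mean_step b (p * (b + 1)) n.
Proof.
move=> b1 p0 n0; set q := p * (b + 1).
have b10 : 0 < b + 1 by lra.
have q0 : 0 < q by rewrite mulr_gt0.
have c0 := c_gt0 b1 (ltn0Sn n).
have nr0 : 0 < (n%:R : R) by rewrite ltr0n.
transitivity (q * (\sum_(1 <= k < n.+1) c_ k b * mean_step b q k.-1)
              / (n%:R * c_ n.+1 b)).
  rewrite mulrAC mulr_sumr; apply: eq_bigr => k _; rewrite /q.
  move: (c_ k b) (c_ n.+1 b) c0 => ck cn cn0.
  by field; rewrite !gt_eqF.
by rewrite sum_c_mean_step//; field; rewrite !gt_eqF.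
Qed.

(** Telescoping: by [mean_stepS] the increment of (n+b) E X_(n+1) is
    ((n+q) - (n+b)) E X_(n+1). *)
Lemma sum_mean_step b q n : -1 < b -> 0 < q ->
  (q - b) * \sum_(j < n) mean_step b q j = (n%:R + b) * mean_step b q n - b.
Proof.
move=> b1 q0; elim: n => [|n IH].
  by rewrite big_ord0 mean_step0// mulr0 add0r mulr1 subrr.
by rewrite big_ord_recr/= mulrDr IH mean_stepS//; ring.
Qed.

Lemma mean_step_diag b n : 0 < b -> mean_step b b n = b / (n%:R + b).
Proof.
move=> b0; have n0 : 0 <= (n%:R : R) by rewrite ler0n.
have nb0 : 0 < n%:R + b by lra.
rewrite /mean_step gammaD1//.
have -> : n.+1%:R + b = n%:R + b + 1 by rewrite -natr1; ring.
by rewrite gammaD1//; field; rewrite ?gt_eqF ?gamma_gt0//.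
Qed.

Lemma cvg_mean_step b q : -1 < b -> 0 < q ->
  (n%:R + b) * mean_step b q n / n%:R `^ (q - b) @[n --> \oo]
    --> gamma (b + 1) / gamma q.
Proof.
move=> b1 q0; set K := _ / _.
have /(_ _) := @cvgMr _ _ _ _ _ K _ (cvg_gamma_quot (ltW q0) b1).
rewrite mulr1; apply: eventually_eq_cvg; near=> n.
have n1 : 1 <= (n%:R : R) by rewrite ler1n; near: n; exact: nbhs_infty_gt.
have nb0 : 0 < n%:R + b by lra.
have n0 : 0 < (n%:R : R) by lra.
rewrite /mean_step -/K.
have -> : n.+1%:R + b = n%:R + b + 1 by rewrite -natr1; ring.
by rewrite gammaD1//; field; rewrite !gt_eqF// ?powR_gt0 ?gamma_gt0//.
Unshelve. all: by end_near. Qed.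

Lemma cvg_sum_mean_step_fin b q : 0 < q -> q < b ->
  \sum_(j < n) mean_step b q j @[n --> \oo] --> b / (b - q).
Proof.
move=> q0 qb; have b1 : -1 < b by lra.
have qb0 : q - b < 0 by lra.
have /(_ _) := cvgM (cvg_mean_step b1 q0) (cvgr_powRn_neg qb0).
rewrite mulr0 => lim0.
have : (q - b)^-1 * ((n%:R + b) * mean_step b q n / n%:R `^ (q - b)
    * n%:R `^ (q - b) - b) @[n --> \oo] --> (q - b)^-1 * (0 - b).
  by apply: cvgMr; apply: cvgB => //; exact: cvg_cst.
have -> : (q - b)^-1 * (0 - b) = b / (b - q).
  by field; apply/andP; split; apply/eqP; lra.
apply: eventually_eq_cvg; near=> n.
have n0 : 0 < (n%:R : R) by rewrite ltr0n; near: n; exact: nbhs_infty_gt.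
rewrite divfK ?gt_eqF ?powR_gt0// -sum_mean_step//.
by rewrite mulKf// lt_eqF.
Unshelve. all: by end_near. Qed.

Lemma asymp_sum_mean_step b q : -1 < b -> 0 < q -> b < q ->
  asymp_equiv (fun n => \sum_(j < n) mean_step b q j)
    (fun n => 1 / (q - b) * (gamma (b + 1) / gamma q) * n%:R `^ (q - b)).
Proof.
move=> b1 q0 qb; rewrite /asymp_equiv; set K := gamma (b + 1) / gamma q.
have b10 : 0 < b + 1 by lra.
have K0 : 0 < K by rewrite divr_gt0// gamma_gt0.
have qb0 : b - q < 0 by lra.
have qb1 : 0 < q - b by lra.
have := cvg_mean_step b1 q0; rewrite -/K => lim1.
have : K^-1 * ((n%:R + b) * mean_step b q n / n%:R `^ (q - b))
   - K^-1 * b * n%:R `^ (b - q)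
  @[n --> \oo] --> K^-1 * K - K^-1 * b * 0.
  apply: cvgB; first exact: cvgMr.
  by apply: cvgMr; exact: cvgr_powRn_neg.
rewrite mulr0 subr0 mulVf ?gt_eqF//; apply: eventually_eq_cvg; near=> n.
have n0 : 0 < (n%:R : R) by rewrite ltr0n; near: n; exact: nbhs_infty_gt.
have -> : \sum_(j < n) mean_step b q j =
    (q - b)^-1 * ((n%:R + b) * mean_step b q n - b).
  by rewrite -sum_mean_step// mulKf// gt_eqF.
rewrite -[b - q]opprB powRN.
by field; rewrite ?gt_eqF ?powR_gt0//.
Unshelve. all: by end_near. Qed.

Lemma ln_diff_bounds b n : 0 < b ->
  (n.+1%:R + b)^-1 <= ln (n.+1%:R + b) - ln (n%:R + b) <= (n%:R + b)^-1.
Proof.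
move=> b0; have n0 : 0 <= (n%:R : R) by rewrite ler0n.
have x0 : 0 < n%:R + b by lra.
have -> : n.+1%:R + b = n%:R + b + 1 by rewrite -natr1; ring.
move: (n%:R + b) x0 => x x0.
have x10 : 0 < x + 1 by lra.
have ix0 : 0 < x^-1 by rewrite invr_gt0.
have ix1 : 0 < (x + 1)^-1 by rewrite invr_gt0.
have E : x / (x + 1) = 1 - (x + 1)^-1 by field; rewrite gt_eqF.
have E' : (x + 1) / x = 1 + x^-1 by field; rewrite gt_eqF.
have := @le_ln1Dx _ x^-1; rewrite -E' ln_div ?posrE// => up.
have := @le_ln1Dx _ (- (x + 1)^-1); rewrite -E ln_div ?posrE// => down.
have lt1 : (x + 1)^-1 < 1 by rewrite invf_lt1//; lra.
have {}up : ln (x + 1) - ln x <= x^-1 by apply: up; lra.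
have {}down : ln x - ln (x + 1) <= - (x + 1)^-1 by apply: down; lra.
by apply/andP; split; lra.
Qed.

(** When q = b the steps are b/(j+b), and comparing 1/(j+b) with increments of
    the logarithm shows that their sum is b ln n up to a bounded error. *)
Lemma asymp_sum_mean_step_diag b : 0 < b ->
  asymp_equiv (fun n => \sum_(j < n) mean_step b b j) (fun n => b * ln n%:R).
Proof.
move=> b0; rewrite /asymp_equiv.
pose H n : R := \sum_(j < n) (j%:R + b)^-1.
have lo n : ln (n%:R + b) - ln b <= H n.
  elim: n => [|n IH]; first by rewrite add0r subrr /H big_ord0.
  rewrite /H big_ord_recr/= -/(H n).
  have /andP[_ h] := ln_diff_bounds n b0; lra.
have hi n : H n.+1 <= b^-1 + (ln (n%:R + b) - ln b).
  elim: n => [|n IH]; first by rewrite /H big_ord_recl big_ord0 add0r subrr.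
  rewrite /H big_ord_recr/= -/(H n.+1).
  have /andP[h _] := ln_diff_bounds n b0; lra.
(* A and B absorb the bounded errors below and above ln n *)
pose A := `|ln b|; pose B := b^-1 + b - ln b.
have ln_pos : \forall n \near \oo, 0 < ln (n%:R : R).
  by move/cvgryPgt : (@cvgr_ln R); exact.
have cvg_inv : (ln (n%:R : R))^-1 @[n --> \oo] --> 0.
  by apply/gtr0_cvgV0 => //; exact: cvgr_ln.
apply: (@squeeze_cvgr _ _ _ _ (fun n => 1 - A * (ln n%:R)^-1)
  (fun n => 1 + B * (ln n%:R)^-1)); last 2 first.
- rewrite -[X in _ --> X]subr0 -(mulr0 A).
  by apply: cvgB; [exact: cvg_cst|exact: cvgMr].
- rewrite -[X in _ --> X]addr0 -(mulr0 B).
  by apply: cvgD; [exact: cvg_cst|exact: cvgMr].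
near=> n.
have n0 : (0 < n)%N by near: n; exact: nbhs_infty_gt.
have l0 : 0 < ln (n%:R : R) by near: n.
have nr : 1 <= (n%:R : R) by rewrite ler1n.
have E : \sum_(j < n) mean_step b b j = b * H n.
  by rewrite /H mulr_sumr; apply: eq_bigr => j _; rewrite mean_step_diag.
have -> : (\sum_(j < n) mean_step b b j) / (b * ln n%:R) = H n * (ln n%:R)^-1.
  by rewrite E; field; rewrite !gt_eqF.
set l := ln n%:R in l0 *.
have E1 z : 1 + z * l^-1 = (l + z) * l^-1 by field; rewrite gt_eqF.
rewrite -mulNr !E1 !ler_pM2r ?invr_gt0//.
have h1 : l <= ln (n%:R + b) by rewrite /l ler_ln ?posrE//; lra.
have h2 : ln (n%:R + b) <= l + b.
  have -> : n%:R + b = n%:R * (1 + b / n%:R) by field; apply/eqP; lra.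
  have bn : 0 < b / n%:R by rewrite divr_gt0//; lra.
  rewrite lnM ?posrE; [|lra|lra].
  rewrite lerD2l (le_trans (le_ln1Dx _))//; first by lra.
  by rewrite ler_pdivrMr; [rewrite ler_peMr; lra|lra].
have h3 : H n <= H n.+1 by rewrite /H big_ord_recr/= lerDl invr_ge0; lra.
have h4 := ler_norm (ln b).
have h5 := lo n; have h6 := hi n.
by rewrite /A /B; apply/andP; split; lra.
Unshelve. all: by end_near. Qed.

End mean_step.

(** * The means of the steps of the walk *)

Section walk.
Context {R : realType} {p b : R} {d : measure_display} {T : measurableType d}
  {P : probability T R} {alpha : nat -> {RV P >-> bool}}
  {beta X : nat -> {RV P >-> nat}}.
Context (hp0 : 0 < p) (hp1 : p < 1) (hb : -1 < b).
Context (hwalk : laziest_erw p b alpha beta X).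
Implicit Types (J : {fset nat}) (v : nat -> nat) (k l n : nat).

(** The events met when the ancestry of a step is traced back: each step taken
    at a time j in J is a genuine copy, with prescribed origin v j. *)
Definition trail J v : set T :=
  \bigcap_(i in [set` J]) (alpha i @^-1` [set true]) `&`
  \bigcap_(i in [set` J]) (beta i @^-1` [set v i]).

Lemma sigma_generated_bigcap {d'} {T' : measurableType d'}
    (Y : nat -> {RV P >-> T'}) (B : nat -> set T') (D : set nat) J :
  [set` J] `<=` D -> (forall i, measurable (B i)) ->
  sigma_generated D Y (\bigcap_(i in [set` J]) (Y i @^-1` B i)).
Proof.
move=> JD mB.
apply: (@fin_bigcap_measurable _ (g_sigma_algebraType
  (\bigcup_(i in D) preimage_set_system setT (Y i) measurable))).
  exact: finite_fset.
move=> i /= iJ; apply: sub_gen_smallest; exists i; first exact: JD.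
by exists (B i) => //; rewrite setTI.
Qed.

Lemma P_alpha k : (2 <= k)%N -> P (alpha k @^-1` [set true]) = p%:E.
Proof.
case: k => [//|k] k1; have := erw_alpha_law hwalk [set true] (k1 : (1 <= k)%N).
rewrite /distribution /pushforward => ->.
rewrite bernoulli_probE ?(ltW hp0) ?(ltW hp1)//.
by rewrite !diracE mem_set// memNset//= mule1 mule0 adde0.
Qed.

Lemma P_trail J v : (forall j, j \in J -> (2 <= j)%N) ->
  P (trail J v) =
    (\prod_(i <- J) (p%:E * P (beta i @^-1` [set v i])))%E.
Proof.
move=> J2; have JD : [set` J] `<=` [set k | (2 <= k)%N] by move=> j /= /J2.
rewrite /trail (erw_alpha_beta_indep hwalk); last 2 first.
- exact: (@sigma_generated_bigcap _ _ alpha (fun=> [set true])).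
- exact: (@sigma_generated_bigcap _ _ beta (fun i => [set v i])).
rewrite (erw_alpha_indep hwalk (B := fun=> [set true]))//.
rewrite (erw_beta_indep hwalk (B := fun i => [set v i]))//.
rewrite [RHS]big_split/=; congr (_ * _)%E.
by rewrite big_seq [RHS]big_seq; apply: eq_bigr => i /J2; exact: P_alpha.
Qed.

Lemma measurable_trail J v : measurable (trail J v).
Proof.
apply: measurableI; apply: fin_bigcap_measurable => //; try exact: finite_fset.
- by move=> i _; rewrite -[X in measurable X]setTI; exact: measurable_funP.
- by move=> i _; rewrite -[X in measurable X]setTI; exact: measurable_funP.
Qed.

Definition extend k l v i := if i == k then l else v i.

Lemma trailU1 J v k l : k \notin J ->
  trail (k |` J)%fset (extend k l v) =
  trail J v `&` (alpha k @^-1` [set true] `&` beta k @^-1` [set l]).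
Proof.
move=> kJ; apply/seteqP; split => w.
  move=> [/= Aw Bw]; split; first split => i /= iJ.
  - by apply: Aw; rewrite /= in_fset1U iJ orbT.
  - have := Bw i; rewrite /= in_fset1U iJ orbT => /(_ isT); rewrite /extend.
    by case: eqP => // ik; rewrite -ik iJ in kJ.
  - split; first by apply: Aw; rewrite /= in_fset1U eqxx.
    by have := Bw k; rewrite /= in_fset1U eqxx /extend eqxx => /(_ isT).
move=> [[/= Aw Bw] [ak bk]]; split => i /=; rewrite in_fset1U.
  by case/orP => [/eqP ->//|]; exact: Aw.
rewrite /extend; case: eqP => [->//|_ /= iJ]; exact: Bw.
Qed.

Lemma P_trailU1 J v k l : (2 <= k)%N -> (forall j, j \in J -> (k < j)%N) ->
  P (trail (k |` J)%fset (extend k l v)) =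
  (P (trail J v) * (p%:E * P (beta k @^-1` [set l])))%E.
Proof.
move=> k2 kJ.
have kNJ : k \notin J by apply/negP => /kJ; rewrite ltnn.
rewrite !P_trail; last 2 first.
- by move=> j /kJ /ltnW; exact: leq_trans.
- by move=> j; rewrite in_fset1U => /orP[/eqP ->//|/kJ /ltnW]; exact: leq_trans.
rewrite big_fsetU1//= muleC /extend eqxx; congr (_ * _)%E.
rewrite big_seq [RHS]big_seq; apply: eq_bigr => j jJ.
by case: eqP => // jk; rewrite -jk jJ in kNJ.
Qed.

(** Each value outside 1, ..., n has probability 0 and there are countably many
    of them; elsewhere than on this null set X_(n+1) is read off the past. *)
Lemma beta_range n : (1 <= n)%N -> {ae P, forall w, (1 <= beta n.+1 w <= n)%N}.
Proof.
move=> n1; apply: (@negligibleS _ _ _ _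
   (\bigcup_k (if (1 <= k <= n)%N then set0 else beta n.+1 @^-1` [set k]))).
  move=> w /= Nw; exists (beta n.+1 w) => //.
  by case: ifPn => // /Nw.
apply: negligible_bigcup => k; case: ifPn => kn; first exact: negligible_set0.
exists (beta n.+1 @^-1` [set k]); split => //.
  by rewrite -[X in measurable X]setTI; exact: measurable_funP.
by have := erw_beta_pmf hwalk k n1; rewrite (negbTE kn).
Qed.

Definition step k (w : T) : \bar R := (X k w)%:R%:E.

Lemma measurable_step k D : measurable_fun D (step k).
Proof.
apply: measurable_funTS; apply/measurable_EFinP.
by apply: (@measurableT_comp _ _ _ _ _ _ (fun m : nat => m%:R : R)).
Qed.

Lemma measurable_step_restrict k D : measurable D ->
  measurable_fun setT (step k \_ D).
Proof.
move=> mD; apply: (measurable_restrictT (step k) mD).1.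
exact: measurable_step.
Qed.

(** Splitting according to the remembered time l lengthens the trail by one time
    and trades the step n+1 for the step l. *)
Lemma step_decomp n J v w : (1 <= n)%N -> n.+1 \notin J ->
  (1 <= beta n.+1 w <= n)%N ->
  (step n.+1 \_ (trail J v)) w =
  (\sum_(1 <= l < n.+1)
     (step l \_ (trail (n.+1 |` J)%fset (extend n.+1 l v))) w)%E.
Proof.
move=> n1 nJ /andP[b1 bn].
under eq_bigr do rewrite trailU1// patchE.
rewrite patchE /step (erw_XS hwalk)//.
have [wt|wt] := boolP (w \in trail J v); last first.
  rewrite big1// => l _; rewrite ifF//; apply: contraNF wt => /set_mem[+ _].
  exact: mem_set.
case aw: (alpha n.+1 w); last first.
  rewrite mul0n big1// => l _; rewrite ifF//; apply: memNset => -[_ [/= + _]].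
  by rewrite aw.
rewrite mul1n (bigD1_seq (beta n.+1 w)) ?iota_uniq//=; last first.
  by rewrite mem_index_iota b1.
rewrite mem_set; last by split; [exact: set_mem|].
rewrite big1 ?adde0// => l lb; rewrite ifF//; apply: memNset => -[_ [_ /= bl]].
by rewrite bl eqxx in lb.
Qed.

(** The step k is uncorrelated with every trail in its strict future.
    Quantifying over all such trails is what makes the induction close:
    conditioning on beta_k extends the trail by the time k, which lies in the
    future of every l < k. *)
Lemma integral_trail_step k J v :
  (1 <= k)%N -> (forall j, j \in J -> (k < j)%N) ->
  (\int[P]_(w in trail J v) step k w =
   P (trail J v) * (mean_step b (p * (b + 1)) k.-1)%:E)%E.
Proof.
have b10 : 0 < b + 1 by rewrite -ltrBlDr sub0r.
elim/ltn_ind: k J v => -[//|[|n]] IH J v _ kJ.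
  rewrite mean_step0 ?mulr_gt0// mule1.
  under eq_integral do rewrite /step (erw_X1 hwalk).
  by rewrite integral_cst ?mul1e//; exact: measurable_trail.
rewrite integral_mkcond.
have kNJ : n.+2 \notin J by apply/negP => /kJ; rewrite ltnn.
have mt l : measurable_fun setT
    (step l \_ (trail (n.+2 |` J)%fset (extend n.+2 l v))).
  exact/measurable_step_restrict/measurable_trail.
have t0 l w : (0 <= (step l \_ (trail (n.+2 |` J)%fset (extend n.+2 l v))) w)%E.
  by apply: erestrict_ge0 => ? _; rewrite lee_fin.
rewrite (@ge0_ae_eq_integral _ _ _ _ setT _ (fun w => \sum_(1 <= l < n.+2)
     (step l \_ (trail (n.+2 |` J)%fset (extend n.+2 l v))) w)%E)//;
  last 5 first.
- exact/measurable_step_restrict/measurable_trail.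
- exact: emeasurable_sum.
- by move=> w _; apply: erestrict_ge0 => ? _; rewrite lee_fin.
- by move=> w _; apply: sume_ge0.
- by have := @beta_range n.+1 isT; apply: filterS => w bw _; exact: step_decomp.
rewrite ge0_integral_sum//.
have [r Pr] : exists r, P (trail J v) = r%:E.
  exists (fine (P (trail J v))); rewrite fineK// fin_num_measure//.
  exact: measurable_trail.
rewrite Pr -mean_step_rec//= -EFinM mulr_sumr -sumEFin.
rewrite big_nat_cond [RHS]big_nat_cond; apply: eq_bigr => l.
rewrite andbT => /andP[l1 ln]; rewrite -integral_mkcond IH//; last first.
  by move=> j; rewrite in_fset1U => /orP[/eqP ->//|/kJ]; exact: ltn_trans.
rewrite P_trailU1// Pr (erw_beta_pmf hwalk)// l1 -ltnS ln -!EFinM.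
by rewrite /= -mulrA.
Qed.

Lemma integral_step k : (1 <= k)%N ->
  (\int[P]_w step k w = (mean_step b (p * (b + 1)) k.-1)%:E)%E.
Proof.
move=> k1; have := @integral_trail_step k fset0 id k1.
have -> : trail fset0 id = setT.
  by apply/seteqP; split => // w _; split => i /=; rewrite in_fset0.
by rewrite probability_setT mul1e; apply => j; rewrite in_fset0.
Qed.

(** * The position of the walk and its limit *)

Definition position n (w : T) : \bar R := (Xi X n w)%:R%:E.

Lemma positionE n w : position n w = (\sum_(1 <= k < n.+1) step k w)%E.
Proof. by rewrite /position /Xi natr_sum sumEFin. Qed.

Lemma measurable_position n : measurable_fun setT (position n).
Proof.
apply: (eq_measurable_fun (fun w => \sum_(1 <= k < n.+1) step k w)%E).
  by move=> w _; rewrite positionE.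
by apply: emeasurable_sum => k; exact: measurable_step.
Qed.

Lemma integral_position n :
  (\int[P]_w position n w = (\sum_(j < n) mean_step b (p * (b + 1)) j)%:E)%E.
Proof.
under eq_integral do rewrite positionE.
rewrite ge0_integral_sum//; last 2 first.
- by move=> k; exact: measurable_step.
- by move=> k w _; rewrite lee_fin.
rewrite -(big_mkord xpredT (mean_step b (p * (b + 1)))) -sumEFin.
rewrite big_add1 /= big_nat [RHS]big_nat.
by apply: eq_bigr => k _; rewrite integral_step.
Qed.

Lemma integral_Xi_infty :
  (\int[P]_w position n w)%E @[n --> \oo] --> (\int[P]_w Xi_infty R X w)%E.
Proof.
apply: cvg_monotone_convergence => //.
- exact: measurable_position.
- by move=> n w _; rewrite lee_fin.
- move=> w _ m n mn; rewrite lee_fin ler_nat /Xi.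
  by rewrite [leqRHS](@big_cat_nat _ _ _ m.+1)//= leq_addr.
Qed.

Lemma measurable_Xi_infty : measurable_fun setT (Xi_infty R X).
Proof.
apply: (emeasurable_fun_cvg position) => [n|w _].
  exact: measurable_position.
exact: Xi_cvg.
Qed.

Lemma Xi_infty_ge0 w : (0 <= Xi_infty R X w)%E.
Proof.
apply: lime_ge; first by apply/cvg_ex; eexists; exact: Xi_cvg.
by apply: nearW => n; rewrite lee_fin.
Qed.

Lemma Xi_infty_ae_lty : (\int[P]_w Xi_infty R X w < +oo)%E ->
  {ae P, forall w, (Xi_infty R X w < +oo)%E}.
Proof.
move=> fin; have : P.-integrable setT (Xi_infty R X).
  apply/integrableP; split; first exact: measurable_Xi_infty.
  by under eq_integral do rewrite gee0_abs ?Xi_infty_ge0//.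
move/(integrable_ae measurableT); apply: filterS => w /(_ I).
by rewrite ge0_fin_numE// Xi_infty_ge0.
Qed.

End walk.

Theorem corollary2p2 (R : realType) (p b : R)
  (hp0 : 0 < p) (hp1 : p < 1) (hb : -1 < b)
  (d : measure_display) (T : measurableType d) (P : probability T R)
  (alpha : nat -> {RV P >-> bool}) (beta X : nat -> {RV P >-> nat})
  (hwalk : laziest_erw p b alpha beta X) :
  let EXi (n : nat) : \bar R := ('E_P[fun w => (Xi X n w)%:R])%E in
  [/\ b < p / (1 - p) ->
        asymp_equiv (fun n => fine (EXi n))
          (fun n => C_const p b * n%:R `^ (p * (b + 1) - b)),
      b = p / (1 - p) ->
        asymp_equiv (fun n => fine (EXi n)) (fun n => b * ln n%:R)
    & p / (1 - p) < b ->
        [/\ (\int[P]_w Xi_infty R X w)%E = (b / (b - p * (b + 1)))%:E,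
            EXi n @[n --> \oo] --> (b / (b - p * (b + 1)))%:E
          & {ae P, forall w, (Xi_infty R X w < +oo)%E}]].
Proof.
move=> EXi; set q := p * (b + 1).
have EXiE n : EXi n = (\sum_(j < n) mean_step b q j)%:E.
  by rewrite /EXi unlock; exact: (integral_position hp0 hp1 hb hwalk).
have fineEXi :
    (fun n => fine (EXi n)) = (fun n => \sum_(j < n) mean_step b q j).
  by apply/funext => n; rewrite EXiE.
have p10 : 0 < 1 - p by rewrite subr_gt0.
have q0 : 0 < q by rewrite mulr_gt0// -ltrBlDr sub0r.
have ltq : (b < p / (1 - p)) = (b < q).
  by rewrite ltr_pdivlMr// /q; apply/idP/idP; lra.
split.
- rewrite ltq fineEXi /C_const GammaE => bq; exact: asymp_sum_mean_step.
- move=> bE; have qE : q = b by rewrite /q bE; field; rewrite gt_eqF.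
  rewrite fineEXi qE; apply: asymp_sum_mean_step_diag.
  by rewrite bE divr_gt0.
- move=> bp; have qb : q < b.
    by move: bp; rewrite ltr_pdivrMr// /q; lra.
  have lim : EXi n @[n --> \oo] --> (b / (b - q))%:E.
    under eq_cvg do rewrite EXiE.
    by apply: cvg_EFin; [exact: nearW|exact: cvg_sum_mean_step_fin].
  have Einf : (\int[P]_w Xi_infty R X w)%E = (b / (b - q))%:E.
    have := @integral_Xi_infty R d T P X.
    under eq_cvg do rewrite (integral_position hp0 hp1 hb hwalk) -EXiE.
    by move=> h; rewrite -(cvg_lim _ h)//; exact/cvg_lim.
  by split => //; apply: Xi_infty_ae_lty; rewrite Einf ltry.
Qed.
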